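(* Let $\{T(t)\}_{t\ge0}$ be a bounded $C_0$-semigroup on a Banach space $X$, and let $P^{\odot}$ be a minimal idempotent in $\mathcal S_0^{\odot}$. Then $X^{\odot}$ decomposes into the direct sum of the two closed and translation-invariant (i.e. $T^{\odot}(t)$-invariant for all $t\ge 0$) subspaces $X_a^{\odot}:=R(P^{\odot})$ (range) and $X_0^{\odot}:=N(P^{\odot})$ (kernel). Moreover: (1) $P^{\odot}\mathcal S_0^{\odot}$ is a group on $X_a^{\odot}$ (i.e. the restrictions to $X_a^\odot$ form a group under composition). (2) $x^{\odot}\in X_a^{\odot}$ iff for every $V\in\mathcal S_0^{\odot}$ there exists $U\in\mathcal S_0^{\odot}$ with $P^{\odot}UP^{\odot}Vx^{\odot}=x^{\odot}$. (3) If $x^{\odot}\in X_0^{\odot}$, then there is a net $\{t_\gamma\}_{\gamma\in\Gamma}\subset[0,\infty)$ such that $\sigma(X^{\odot},X)\text{-}\lim_{\gamma}T^{\odot}(t_\gamma)x^{\odot}=0$. (4) If $x^{\odot}\in X^{\odot}$ and $t\mapsto T^{\odot}(t)x^{\odot}$ is almost periodic, then $x^{\odot}\in X_a^{\odot}$. (5) If $x^{\odot}\in X^{\odot}$ and $\sigma(X^{\odot},X^{\odot*})\text{-}\lim_{\alpha}T^{\odot}(t_\alpha)x^{\odot}=0$ for some net $\{t_\alpha\}_{\alpha\in A}\subset[0,\infty)$, then $x^{\odot}\in X_0^{\odot}$. (6) If $x\in(X_a^{\odot})_\perp:=\{x\in X:\langle x,x^{\odot}\rangle=0\ \forall x^{\odot}\in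 X_a^{\odot}\}$, then there is a net $\{t_\alpha\}_{\alpha\in A}\subset[0,\infty)$ such that $\sigma(X,X^{\odot})\text{-}\lim_{\alpha}T(t_\alpha)x=0$. (7) If $x\in(X_0^{\odot})_\perp:=\{x\in X:\langle x,x^{\odot}\rangle=0\ \forall x^{\odot}\in X_0^{\odot}\}$, then there is a net $\{t_\alpha\}_{\alpha\in A}\subset[0,\infty)$ such that $\sigma(X,X^{\odot})\text{-}\lim_{\alpha}T(t_\alpha)x=x$. (8) Let $Y\subset X^{\odot}$ be a closed subspace and $x^{\odot}\in Y$, and write $x^\odot=x_a^\odot+x_0^\odot$ with $x_a^\odot\in X_a^\odot$, $x_0^\odot\in X_0^\odot$. If $\overline{O(x^{\odot})}^{\sigma(X^{\odot},X)}\subset Y$, then $x_a^{\odot},x_0^{\odot}\in Y$. Consequently, if this inclusion holds for every $x^\odot\in Y$, then $Y=Y_a\oplus Y_0$ with $Y_a:=Y\cap R(P^{\odot})$ and $Y_0:=Y\cap N(P^{\odot})$.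
   Context: Sun dual: $X^{\odot}=\{x^*\in X^*:\lim_{t\to0}\|T^*(t)x^*-x^*\|=0\}$ (norm-closed, weak*-dense, $T^*(t)$-invariant), $T^{\odot}(t)=T^*(t)|_{X^{\odot}}$, $O(x^\odot)=\{T^\odot(t)x^\odot:t\ge0\}$. The topology $\kappa^\odot$ on $L(X^\odot)$: $V_\lambda\to V$ iff $\langle V_\lambda x^\odot,x\rangle\to\langle Vx^\odot,x\rangle$ for all $x\in X$, $x^\odot\in X^\odot$. $\mathcal S_0^\odot$ is the compactification of $\{T^\odot(t):t\ge0\}$: the $\kappa^\odot$-closure of $\{T^\odot(t):t\ge0\}$ in $L(X^\odot)$; equivalently, the set of restrictions to $X^\odot$ of the operators $x^*\mapsto\{x\mapsto\langle Vx,x^*\rangle\}$, where $V$ runs through the closure of $\{T(t):t\ge0\}$ in $L(X,X^{**})$ for the topology of pointwise weak* convergence. It is a $\kappa^\odot$-compact semigroup under composition, and $W\mapsto WV$ is $\kappa^\odot$-continuous on it for each $V\in\mathcal S_0^\odot$. $E(\mathcal S_0^\odot)$ is the set of idempotents; $e\le_Lf$ iff $ef=e$, and $e\le_Rf$ iff $fe=e$. An element $a$ is $\le$-minimal if $a'\le a$ implies $a\le a'$. A minimal idempotent is an element of $E(\mathcal S_0^\odot)$ minimal for $\le_L$ (equivalently for $\le_R$); such idempotents exist. A function on $[0,\infty)$ is called almost periodic if it is the restriction of an almost periodic function on $\mathbb R$, i.e. of a bounded continuous $f:\mathbb R\to X^\odot$ whose set of translates $\{f(\cdot+\tau):\tau\in\mathbb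 R\}$ is relatively compact in $C_b(\mathbb R,X^\odot)$. *)

(* Defs.v *)
From HB Require Import structures.
From mathcomp Require Import all_boot all_order all_algebra.
From mathcomp Require Import complex.
From mathcomp Require Import all_classical all_reals all_analysis.

Set Implicit Arguments.
Unset Strict Implicit.
Unset Printing Implicit Defensive.

Import Order.TTheory GRing.Theory Num.Theory.
Import numFieldNormedType.Exports.

Local Open Scope classical_set_scope.
Local Open Scope ring_scope.

(* The scalar field of a Banach space: the complex numbers or the reals. Norms
   over [scalars R cplx] are valued in this field, whence the coercions to and
   from [R]; [to_real] is only ever applied to norms. *)
Definition scalars (R : realType) (cplx : bool) : numFieldType :=
  if cplx then (R[i] : numFieldType) else (R : numFieldType).

Definition of_real (R : realType) (cplx : bool) : R -> scalars R cplx :=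
  match cplx with true => real_complex R | false => id end.

Definition to_real (R : realType) (cplx : bool) : scalars R cplx -> R :=
  match cplx with true => @complex.Re R | false => id end.

Arguments of_real {R cplx}.
Arguments to_real {R cplx}.

Section scalars_theory.
Context {R : realType} {cplx : bool}.
Local Notation K := (scalars R cplx).
Implicit Types (r s : R) (z : K).

Lemma of_realK : cancel (@of_real R cplx) to_real.
Proof. by case: cplx. Qed.

Lemma to_realK z : 0 <= z -> of_real (to_real z) = z.
Proof.
move: z; rewrite /of_real /to_real /scalars; case: cplx => //= -[a b] /=.
by rewrite lecE /= => /andP[/eqP -> _].
Qed.

Lemma ler_of_real r s : (of_real r <= of_real s :> K) = (r <= s).
Proof.
rewrite /of_real /scalars; case: cplx => //=.
by rewrite lecR.
Qed.

Lemma of_real0 : of_real 0 = 0 :> K.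
Proof. by rewrite /of_real /scalars; case: cplx. Qed.

End scalars_theory.

Section bounded_linear_maps.
Context {K : numFieldType} (V W : normedModType K).

Definition blin_pred : {pred V -> W} :=
  [pred f | `[< linear f /\ continuous f >]].

Record blin := BLin { blin_fun :> V -> W; blinP : blin_fun \in blin_pred }.

HB.instance Definition _ := [isSub for blin_fun].
HB.instance Definition _ := [Choice of blin by <:].

Lemma blin_predP f : reflect (linear f /\ continuous f) (f \in blin_pred).
Proof. exact: asboolP. Qed.

Lemma blin_pred_submod : submod_closed blin_pred.
Proof.
split=> [|a f g].
  apply/blin_predP; split=> [b u v|x]; last exact: cst_continuous.
  by rewrite -[LHS]/(0 : W) -[RHS]/(b *: (0 : W) + 0) scaler0 addr0.
move=> /blin_predP[lf cf] /blin_predP[lg cg]; apply/blin_predP; split=> [b u v|x].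
  rewrite -[LHS]/(a *: f _ + g _) -[RHS]/(b *: (a *: f u + g u) + (a *: f v + g v)).
  by rewrite lf lg !scalerDr !scalerA (mulrC a b) addrACA.
apply: cvgD; last exact: cg.
by apply: cvgZr; exact: cf.
Qed.

HB.instance Definition _ :=
  GRing.isSubmodClosed.Build K (V -> W) blin_pred blin_pred_submod.
HB.instance Definition _ := [SubChoice_isSubLmodule of blin by <:].

Lemma blin_linear (f : blin) : linear f.
Proof. by case: (blin_predP _ (blinP f)). Qed.

Lemma blin_continuous (f : blin) : continuous f.
Proof. by case: (blin_predP _ (blinP f)). Qed.

HB.instance Definition _ (f : blin) :=
  GRing.isLinear.Build K V W _ (blin_fun f) (blin_linear f).

End bounded_linear_maps.

Arguments blin_pred {K} V W.

Lemma blin_comp_subproof {K : numFieldType} {U V W : normedModType K}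
  (f : blin V W) (g : blin U V) : f \o g \in blin_pred U W.
Proof.
apply/blin_predP; split=> [a u v|x]; first by rewrite /= !linearP.
by apply: continuous_comp; exact: blin_continuous.
Qed.

Definition blin_comp {K : numFieldType} {U V W : normedModType K}
  (f : blin V W) (g : blin U V) : blin U W :=
  BLin (blin_comp_subproof f g).

Section operator_norm.
Context {R : realType} {cplx : bool}.
Local Notation K := (scalars R cplx).
Context (V W : normedModType K).
Implicit Types f g : blin V W.

Definition opnorm f : K :=
  of_real (sup [set to_real `|f x| | x in [set x : V | `|x| <= 1]]).

Lemma blin_bounded f : exists2 M : R, 0 <= M &
  forall x, `|f x| <= of_real M * `|x|.
Proof.
have /linear_bounded_continuous/linear_boundedP := @blin_continuous _ _ _ f.
move=> /pinfty_ex_gt0[M M0 fM]; exists (to_real M); first last.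
  by move=> x; rewrite to_realK ?(ltW M0)//; exact: fM.
by rewrite -(@ler_of_real _ cplx) to_realK ?(ltW M0)// of_real0 ltW.
Qed.

Lemma opnorm_has_sup f :
  has_sup [set to_real `|f x| | x in [set x : V | `|x| <= 1]].
Proof.
split; first by exists (to_real `|f 0|), 0 => //=; rewrite normr0 ler01.
have [M M0 fM] := blin_bounded f; exists M => _ [x /= x1 <-].
rewrite -(@ler_of_real _ cplx) to_realK ?normr_ge0// (le_trans (fM x))//.
by rewrite ler_piMr// -(of_real0 (cplx := cplx)) ler_of_real.
Qed.

Lemma opnorm_ge0 f : 0 <= opnorm f.
Proof.
rewrite -(of_real0 (cplx := cplx)) ler_of_real.
apply: (@le_trans _ _ (to_real `|f 0|)).
  by rewrite -(@ler_of_real _ cplx) to_realK ?normr_ge0// of_real0 normr_ge0.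
apply: sup_upper_bound; first exact: opnorm_has_sup.
by exists 0 => //=; rewrite normr0 ler01.
Qed.

Lemma opnorm_ub f x : `|f x| <= opnorm f * `|x|.
Proof.
have [->|x0] := eqVneq x 0; first by rewrite linear0 !normr0 mulr0.
have nx0 : 0 < `|x| by rewrite normr_gt0.
rewrite -ler_pdivrMr// mulrC -[X in X * _]gtr0_norm ?invr_gt0// -normrZ.
rewrite -linearZ -(to_realK (normr_ge0 _)) ler_of_real.
apply: sup_upper_bound; first exact: opnorm_has_sup.
by exists (`|x|^-1 *: x) => //=; rewrite normfZV.
Qed.

Lemma opnorm_le f (M : K) : 0 <= M -> (forall x, `|f x| <= M * `|x|) ->
  opnorm f <= M.
Proof.
move=> M0 fM; rewrite -(to_realK M0) ler_of_real.
apply: ge_sup; first by case: (opnorm_has_sup f).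
move=> _ [x /= x1 <-]; rewrite -(@ler_of_real _ cplx) !to_realK ?normr_ge0//.
by rewrite (le_trans (fM x))// ler_piMr.
Qed.

Lemma opnorm_triangle f g : opnorm (f + g) <= opnorm f + opnorm g.
Proof.
apply: opnorm_le => [|x]; first by rewrite addr_ge0 ?opnorm_ge0.
rewrite mulrDl (le_trans _ (lerD (opnorm_ub f x) (opnorm_ub g x)))//.
exact: ler_normD.
Qed.

Lemma opnormZ (l : K) f : opnorm (l *: f) = `|l| * opnorm f.
Proof.
have opZ a h : opnorm (a *: h) <= `|a| * opnorm h.
  apply: opnorm_le => [|x]; first by rewrite mulr_ge0 ?opnorm_ge0.
  by rewrite -[X in `|X|]/(a *: h x) normrZ -mulrA ler_wpM2l ?opnorm_ub.
apply/eqP; rewrite eq_le opZ/=; have [->|l0] := eqVneq l 0.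
  by rewrite normr0 mul0r opnorm_ge0.
rewrite -ler_pdivlMl ?normr_gt0// -normfV (le_trans _ (opZ _ _))//.
by rewrite scalerA mulVf// scale1r.
Qed.

Lemma opnorm0_eq0 f : opnorm f = 0 -> f = 0.
Proof.
move=> f0; apply/val_inj/funext => x; apply/eqP; rewrite -normr_le0.
by rewrite (le_trans (opnorm_ub f x))// f0 mul0r.
Qed.

HB.instance Definition _ := Lmodule_isNormed.Build K (blin V W)
  opnorm_triangle opnormZ opnorm0_eq0.

End operator_norm.

Lemma bounded_blinP {K : numFieldType} {V W : normedModType K} (f : V -> W)
    (M : K) : linear f -> 0 <= M -> (forall x, `|f x| <= M * `|x|) ->
  f \in blin_pred V W.
Proof.
move=> lf M0 fM; apply/blin_predP; split => //.
pose L : {linear V -> W} := HB.pack f (GRing.isLinear.Build K V W _ f lf).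
apply: (@bounded_linear_continuous _ _ _ L); apply/linear_boundedP.
exists M; split; first exact: ger0_real.
by move=> r Mr x; rewrite (le_trans (fM x))// ler_wpM2r// ltW.
Qed.

Section adjoint.
Context {R : realType} {cplx : bool}.
Local Notation K := (scalars R cplx).

Definition dual (V : normedModType K) := blin V K^o.

HB.instance Definition _ V := NormedModule.on (dual V).

Context {V W : normedModType K} (A : blin V W).

Lemma adjoint_subproof :
  (fun phi : dual W => blin_comp phi A : dual V) \in blin_pred (dual W) (dual V).
Proof.
apply: (@bounded_blinP _ _ _ _ (opnorm A)).
- by move=> a phi psi; exact/val_inj.
- exact: opnorm_ge0.
- move=> phi; apply: opnorm_le => [|x]; first by rewrite mulr_ge0 ?opnorm_ge0.
  rewrite mulrAC mulrC (le_trans (opnorm_ub phi (A x)))//.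
  by rewrite ler_wpM2l ?opnorm_ge0// opnorm_ub.
Qed.

Definition adjoint : blin (dual W) (dual V) := BLin adjoint_subproof.

End adjoint.

Section semigroup.
Context {R : realType} {cplx : bool}.
Local Notation K := (scalars R cplx).

(* The operators [sg_op t] with [t < 0] are unconstrained and never used. *)
Record bounded_C0_semigroup (X : normedModType K) := BoundedC0Semigroup {
  sg_op :> R -> blin X X;
  sg_op0 : sg_op 0 = id :> (X -> X);
  sg_opD : forall s t, 0 <= s -> 0 <= t ->
    sg_op (s + t) = sg_op s \o sg_op t :> (X -> X);
  sg_cvg0 : forall x, sg_op t x @[t --> 0^'+] --> x;
  sg_bounded : exists M : K, forall t, 0 <= t -> `|sg_op t| <= M }.

Context {X : normedModType K} (T : bounded_C0_semigroup X).

Definition sun_pred : {pred dual X} :=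
  [pred phi | `[< `|adjoint (T t) phi - phi| @[t --> 0^'+] --> (0 : K) >]].

Record sun := Sun { sun_val :> dual X; sunP : sun_val \in sun_pred }.

HB.instance Definition _ := [isSub for sun_val].
HB.instance Definition _ := [Choice of sun by <:].

Lemma sun_predP phi :
  reflect (adjoint (T t) phi @[t --> 0^'+] --> phi) (phi \in sun_pred).
Proof.
apply: (iffP (asboolP _)) => [/norm_cvg0P/subr_cvg0|]; first exact.
by move=> /subr_cvg0/norm_cvg0P.
Qed.

Lemma sun_pred_submod : submod_closed sun_pred.
Proof.
split=> [|a phi psi /sun_predP Tphi /sun_predP Tpsi]; apply/sun_predP.
  rewrite [X in X @ _](_ : _ = cst 0); first exact: cvg_cst.
  by apply/funext => t; rewrite linear0.
rewrite [X in X @ _](_ : _ =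
    fun t => a *: adjoint (T t) phi + adjoint (T t) psi).
  by apply: cvgD => //; exact: cvgZr.
by apply/funext => t; rewrite linearP.
Qed.

HB.instance Definition _ :=
  GRing.isSubmodClosed.Build K (dual X) sun_pred sun_pred_submod.
HB.instance Definition _ := [SubChoice_isSubLmodule of sun by <:].

Let sun_norm (phi : sun) : K := `|sun_val phi|.

Let sun_ler_normD phi psi : sun_norm (phi + psi) <= sun_norm phi + sun_norm psi.
Proof. exact: ler_normD. Qed.

Let sun_normrZ (a : K) phi : sun_norm (a *: phi) = `|a| * sun_norm phi.
Proof. exact: normrZ. Qed.

Let sun_normr0_eq0 phi : sun_norm phi = 0 -> phi = 0.
Proof. by move=> /normr0_eq0 phi0; exact/val_inj. Qed.

HB.instance Definition _ := Lmodule_isNormed.Build K sun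
  sun_ler_normD sun_normrZ sun_normr0_eq0.

Lemma sun_invariant (t : {nonneg R}) (phi : sun) :
  adjoint (T t%:num) (sun_val phi) \in sun_pred.
Proof.
apply/sun_predP; have /sun_predP Tphi := sunP phi.
have := continuous_cvg _ (h := adjoint (T t%:num))
  (@blin_continuous _ _ _ (adjoint (T t%:num)) (sun_val phi)) Tphi.
move=> TTphi; apply: (cvg_trans _ (TTphi _)); apply: near_eq_cvg.
near=> s; apply/val_inj/funext => x /=.
have s0 : 0 <= s by near: s; apply: nbhs_right_ge.
suff -> : T t%:num (T s x) = T s (T t%:num x) by [].
by rewrite -[LHS]/((T t%:num \o T s) x) -sg_opD// addrC sg_opD.
Unshelve. all: by end_near. Qed.

Lemma sun_op_subproof (t : {nonneg R}) :
  (fun phi => Sun (sun_invariant t phi)) \in blin_pred sun sun.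
Proof.
apply: (@bounded_blinP _ _ _ _ (opnorm (adjoint (T t%:num)))).
- by move=> a phi psi; apply/val_inj; exact: (linearP (adjoint (T t%:num))).
- exact: opnorm_ge0.
- by move=> phi; exact: opnorm_ub.
Qed.

Definition sun_op (t : {nonneg R}) : blin sun sun := BLin (sun_op_subproof t).

End semigroup.

Record directed_set := DirectedSet {
  dir_sort :> Type;
  dir_le : dir_sort -> dir_sort -> Prop;
  dir_inhabited : inhabited dir_sort;
  dir_refl : forall i, dir_le i i;
  dir_trans : forall i j k, dir_le i j -> dir_le j k -> dir_le i k;
  dir_bound : forall i j, exists2 k, dir_le i k & dir_le j k }.

Definition tails (D : directed_set) : set_system D :=
  [set A | exists i, forall j, dir_le i j -> A j].

Arguments tails : clear implicits.

Definition net_cvg (Y : topologicalType) (D : directed_set) (y_ : D -> Y)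
  (y : Y) : Prop := y_ i @[i --> tails D] --> y.

Section almost_periodic.
Context {R : realType} {K : numFieldType} {E : normedModType K}.

Definition Cb : set {uniform R -> E} :=
  [set f | continuous (f : R -> E) /\ bounded_fun (f : R -> E)].

Definition translates (f : R -> E) : set {uniform R -> E} :=
  [set (fun s => f (s + tau)) | tau in [set: R]].

(* [closure] is taken in all of [{uniform R -> E}], so intersecting it with
   [Cb] gives the closure relative to the space of bounded continuous
   functions with the sup norm. *)
Definition almost_periodic (f : R -> E) : Prop :=
  Cb f /\ compact (Cb `&` closure (translates f)).

Definition almost_periodic_half_line (g : {nonneg R} -> E) : Prop :=
  exists2 f : R -> E, almost_periodic f & forall t, f t%:num = g t.

End almost_periodic.

Section idempotents.
Context {K : numFieldType} {V : normedModType K} (S : set (blin V V)).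

Definition idempotents : set (blin V V) :=
  [set e | S e /\ blin_comp e e = e].

Definition le_L (e f : blin V V) : Prop := blin_comp e f = e.

Definition minimal_idempotent (e : blin V V) : Prop :=
  idempotents e /\ forall f, idempotents f -> le_L f e -> le_L e f.

End idempotents.

Definition is_subspace {K : numFieldType} {V : lmodType K} (Y : set V) : Prop :=
  Y 0 /\ forall (a : K) u v, Y u -> Y v -> Y (a *: u + v).

Definition is_direct_sum {K : numFieldType} {V : lmodType K} (A B Y : set V) :
    Prop :=
  [set a + b | a in A & b in B] = Y /\ A `&` B = [set 0].

Definition transformation_group {A : Type} (G : set (A -> A)) : Prop :=
  [/\ G id,
      forall g h, G g -> G h -> G (g \o h) &
      forall g, G g -> exists h, [/\ G h, g \o h = id & h \o g = id]].

(* The self-maps of [A] that are restrictions of elements of [G]. *)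
Definition restrictions {V : Type} (A : set V) (G : set (V -> V)) :
    set (A -> A) :=
  [set g | exists2 f, G f & forall a, set_val (g a) = f (set_val a)].

Arguments restrictions {V} A G _.

Section sun_topologies.
Context {R : realType} {cplx : bool}.
Local Notation K := (scalars R cplx).
Context {X : normedModType K} (T : bounded_C0_semigroup X).

(* The weak topologies sigma(X^sun, X), sigma(X^sun, X^sun* ) and
   sigma(X, X^sun). *)
Definition sigma_sun_X : topologicalType :=
  initial_topology ((fun phi => sun_val phi) : sun T -> {ptws X -> K}).

Definition sigma_sun_dual : topologicalType :=
  initial_topology ((fun phi xi => xi phi) : sun T -> {ptws dual (sun T) -> K}).

Definition sigma_X_sun : topologicalType :=
  initial_topology ((fun x phi => sun_val phi x) : X -> {ptws sun T -> K}).

Definition kappa_sun : topologicalType :=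
  initial_topology ((fun V p => sun_val (V p.1) p.2) :
    blin (sun T) (sun T) -> {ptws (sun T * X)%type -> K}).

Definition S0 : set (blin (sun T) (sun T)) :=
  @closure kappa_sun (range (sun_op T)).

Definition sun_orbit (phi : sun T) : set (sun T) :=
  range (fun t => sun_op T t phi).

Definition pre_annihilator (A : set (sun T)) : set X :=
  [set x | forall phi, A phi -> sun_val phi x = 0].

End sun_topologies.

Arguments S0 {R cplx X} T _.

(* Main.v *)
Require Import Defs.
From HB Require Import structures.
From mathcomp Require Import all_boot all_order all_algebra.
From mathcomp Require Import complex ring.
From mathcomp Require Import all_classical all_reals all_analysis.

(* [S0] is a compact semigroup in which right multiplications are continuous and
   every operator commutes with the [sun_op T t]. By Ellis' theorem every left
   ideal [S0 V P] contains an idempotent, so minimality of [P] provides [U] in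
   [S0] with [U V P = P]; this makes [P S0 P] a group with unit [P] and kills the
   range component of an orbit that has 0 as a weak limit point. The statements
   about nets follow from [P] being a limit of operators [sun_op T t]. If the
   orbit of [phi] is almost periodic then [psi = phi - P phi] satisfies both
   [sun_op T t psi --> 0], by precompactness of the orbit, and
   [|sun_op T t psi - psi| < e] for arbitrarily large [t], whence [psi = 0]. *)

Set Implicit Arguments.
Unset Strict Implicit.
Unset Printing Implicit Defensive.

Import Order.TTheory GRing.Theory Num.Theory.
Import numFieldNormedType.Exports.

Local Open Scope classical_set_scope.
Local Open Scope ring_scope.

(** * Idempotents in compact right topological semigroups *)

Section right_topological_semigroup.
Context {Y : topologicalType} (op : Y -> Y -> Y) (opA : associative op)
  (Yhaus : hausdorff_space Y) (op_cts : forall v, continuous (op ^~ v)).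

Let subsemigroup (B : set Y) := forall u v, B u -> B v -> B (op u v).

(** Zorn's lemma for reverse inclusion: by compactness a chain of nonempty closed subsemigroups of
    [A] has a nonempty intersection, which is again a closed subsemigroup. *)
Let minimal_subsemigroup (A : set Y) : compact A -> A !=set0 ->
  subsemigroup A -> exists B, [/\ B `<=` A, closed B, B !=set0, subsemigroup B &
    forall C, C `<=` B -> closed C -> C !=set0 -> subsemigroup C -> B `<=` C].
Proof.
move=> cA A0 sA; have clA := compact_closed Yhaus cA.
pose good B := [/\ B `<=` A, closed B, B !=set0 & subsemigroup B].
have goodA : good A by split.
pose S := {B : set Y | good B}.
pose Rel (B C : S) := `[< sval C `<=` sval B >].
have [t|r s t /asboolP rs /asboolP st|F Ftot|[B goodB] Bmax] :=
  @ZL_preorder S (exist _ A goodA) Rel.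
- exact/asboolP.
- by apply/asboolP; exact: subset_trans rs.
(* Adjoining [A] keeps the family nonempty even when the chain [F] is empty. *)
- pose D := [set B : set Y | B = A \/ exists2 C, F C & sval C = B].
  have Dgood B : D B -> good B by case=> [->//|[C _ <-]]; exact: (svalP C).
  have Dtot B C : D B -> D C -> B `<=` C \/ C `<=` B.
    move=> DB DC; have [BA _ _ _] := Dgood _ DB; have [CA _ _ _] := Dgood _ DC.
    case: DB BA => [-> _|[B' FB' <-] _]; first by right.
    case: DC CA => [-> _|[C' FC' <-] _].
      by left; have [] := svalP B'.
    by have [/asboolP|/asboolP] := Ftot _ _ FB' FC'; [right|left].
  pose G := filter_from D id.
  have GF : ProperFilter G.
    apply: filter_from_proper => [|B /Dgood[]//].
    apply: filter_from_filter; first by exists A; left.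
    move=> B C DB DC; have [BC|CB] := Dtot _ _ DB DC.
      by exists B => // x Bx; split => //; exact: BC.
    by exists C => // x Cx; split => //; exact: CB.
  have GA : G A by exists A; [left|].
  have [p [Ap Gp]] := cA _ GF GA.
  pose E := [set y | forall B, D B -> B y].
  have goodE : good E.
    split => [y /(_ A (or_introl erefl))//|||].
    + suff -> : E = \bigcap_(B in D) B by apply: closed_bigI => B /Dgood[].
      by [].
    + exists p => B DB; have [_ clB _ _] := Dgood _ DB; apply: clB.
      by move=> C pC; apply: Gp => //; exists B.
    + move=> u v Eu Ev B DB; have [_ _ _ sB] := Dgood _ DB.
      by apply: sB; [exact: Eu|exact: Ev].
  exists (exist _ E goodE) => C FC; apply/asboolP => y /= Ey.
  by apply: Ey; right; exists C.
- have [BA clB B0 sB] := goodB; exists B; split => // C CB clC C0 sC.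
  have goodC : good C by split => //; exact: subset_trans BA.
  by have /asboolP := Bmax (exist _ C goodC) (introT (asboolP _) CB).
Qed.

(* Ellis: in a minimal closed subsemigroup [B] and for [v] in [B], first
   [B v = B] and then [{w in B | w v = v} = B], so that [v v = v]. *)
Lemma exists_idempotent (A : set Y) : compact A -> A !=set0 ->
  (forall u v, A u -> A v -> A (op u v)) -> exists2 e, A e & op e e = e.
Proof.
move=> cA A0 sA; have [B [BA clB [v Bv] sB Bmin]] := minimal_subsemigroup cA A0 sA.
exists v; first exact: BA.
have cB : compact B by apply: subclosed_compact cA BA.
have BvB : B `<=` [set op w v | w in B].
  apply: Bmin => [_ [w Bw <-]||/=|].
  - exact: sB.
  - apply: compact_closed => //; apply: continuous_compact cB.
    by apply: continuous_subspaceT; exact: op_cts.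
  - by exists (op v v), v.
  - move=> _ _ [w Bw <-] [z Bz <-]; exists (op (op w v) z); last by rewrite -!opA.
    by apply: (sB) => //; exact: sB.
have [w Bw wv] := BvB _ Bv.
suff BC : B `<=` B `&` [set w | op w v = v] by have [] := BC _ Bv.
apply: Bmin => [u []//|||].
- apply: closedI => //.
  apply: (@preimage_closed _ _ (op ^~ v) [set v]).
    by move=> ? _; exact: op_cts.
  exact: accessible_closed_set1 (hausdorff_accessible Yhaus) _.
- by exists w.
- by move=> y z [By yv] [Bz zv]; split; [exact: sB|rewrite /= -opA zv].
Qed.

(* The left ideal [A v e] contains an idempotent [f]; since [f e = f],
   minimality gives [e = e f], an element of [A v e]. *)
Lemma minimal_idempotent_left_inverse (A : set Y) e v : compact A ->
  (forall u v, A u -> A v -> A (op u v)) -> A e -> op e e = e ->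
  (forall f, A f -> op f f = f -> op f e = f -> op e f = e) ->
  A v -> exists2 u, A u & op u (op v e) = e.
Proof.
move=> cA sA Ae ee emin Av.
have [||_ _ [y Ay <-] [z Az <-]|f [w Aw fE] ff] :=
    @exists_idempotent [set op w (op v e) | w in A].
- apply: continuous_compact cA.
  by apply: continuous_subspaceT; exact: op_cts.
- by exists (op e (op v e)), e.
- exists (op y (op (op v e) z)); last by rewrite -!opA.
  by apply: (sA) => //; apply: (sA) => //; exact: sA.
exists (op e w); first exact: sA.
have Af : A f by rewrite -fE; apply: (sA) => //; exact: sA.
by rewrite -opA fE; apply: emin => //; rewrite -fE -!opA ee.
Qed.

End right_topological_semigroup.

(** * Weak topologies, nets and compactness *)

(** The kappa topology and the three sigma topologies are all initial for a map into a space of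
    scalar functions; this turns convergence in each of them into limits of scalars. *)
Lemma cvg_initial_ptwsP {S : choiceType} {I : topologicalType} {K : uniformType}
    (h : S -> {ptws I -> K}) (F : set_system S) (s : S) : Filter F ->
  F --> (s : initial_topology h) <->
  forall i, h x i @[x --> F] --> h s i.
Proof.
move=> FF; split=> [Fs i|Fs A [_ [[B oB <-] Bs] BA]].
  have : h @ F --> h s.
    by move=> B /(@initial_continuous _ _ h s)/Fs.
  by move=> /pointwise_cvgP/(_ i).
have hFs : {ptws, h @ F --> h s} by apply/pointwise_cvgP.
rewrite nbhs_filterE; apply: filterS BA _.
by apply: hFs; exact: open_nbhs_nbhs.
Qed.

Lemma initial_hausdorff {S : choiceType} {T : topologicalType} (h : S -> T) :
  injective h -> hausdorff_space T -> hausdorff_space (initial_topology h).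
Proof.
move=> hinj Thaus x y xy; apply: hinj; apply: Thaus => A B hxA hyB.
have [z [Az Bz]] := xy _ _ (@initial_continuous _ _ h x _ hxA)
  (@initial_continuous _ _ h y _ hyB).
by exists (h z).
Qed.

Lemma tails_filter (D : directed_set) : ProperFilter (@tails D).
Proof.
apply: Build_ProperFilter_ex; last split.
- by move=> A [i iA]; exists i; apply: iA; exact: dir_refl.
- by have [j] := dir_inhabited D; exists j.
- move=> A B [i iA] [j jB]; have [k ik jk] := dir_bound i j.
  by exists k => l kl; split; [apply: iA|apply: jB]; apply: dir_trans kl.
- by move=> A B AB [i iA]; exists i => j /iA/AB.
Qed.

(** The net is indexed by pairs of a neighbourhood of [y] and an index whose value lies in it,
    directed by shrinking the neighbourhood. *)
Lemma closure_range_net {Y : topologicalType} {I : Type} (f : I -> Y) y :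
  closure (range f) y ->
  exists (D : directed_set) (g : D -> I), f (g i) @[i --> @tails D] --> y.
Proof.
move=> fy; pose J := {p : set Y * I | nbhs y p.1 /\ p.1 (f p.2)}.
have Jex A : nbhs y A -> exists j : J, (sval j).1 = A.
  move=> yA; have [_ [[i _ <-] Afi]] := fy _ yA.
  by exists (exist _ (A, i) (conj yA Afi)).
pose Jle (j k : J) := (sval k).1 `<=` (sval j).1.
have Jinh : inhabited J by have [j _] := Jex _ (@filterT _ _ (nbhs_filter y)).
have Jrefl j : Jle j j by [].
have Jtrans i j k : Jle i j -> Jle j k -> Jle i k.
  by move=> ij jk; exact: subset_trans ij.
have Jbound i j : exists2 k, Jle i k & Jle j k.
  have [k kE] := Jex _ (filterI (proj1 (svalP i)) (proj1 (svalP j))).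
  by exists k; rewrite /Jle kE => x [].
exists (DirectedSet Jinh Jrefl Jtrans Jbound), (fun j => (sval j).2) => A yA.
have [j jE] := Jex _ yA; exists j => k; rewrite /= /Jle jE; apply.
exact: (proj2 (svalP k)).
Qed.

Lemma fmap_ultra {S T : Type} (f : S -> T) (F : set_system S) :
  UltraFilter F -> UltraFilter (f @ F).
Proof.
move=> FU; apply: Build_UltraFilter => G GF FG; apply/seteqP; split=> // A GA.
have [//|FnA] := in_ultra_setVsetC (f @^-1` A) FU.
by have [x []] := filter_ex (filterI GA (FG (~` A) FnA)).
Qed.

Lemma closed_norm_le {K : numFieldType} {V : normedModType K} (r : K) :
  closed [set z : V | `|z| <= r].
Proof.
(* The order of [K] is only partial: a point [w] of the set shows that [r] is nonnegative, hence
   comparable with the norm of [z]. *)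
move=> z zr; have [w [/= wr _]] := zr _ (@filterT _ _ (nbhs_filter z)).
have r0 : 0 <= r by rewrite (le_trans _ wr).
have [//|rz] := real_leP (normr_real z) (ger0_real r0).
have /zr[y [/= yr]] : nbhs z (ball z (`|z| - r)).
  by apply: nbhsx_ballx; rewrite subr_gt0.
rewrite -ball_normE /= ltrBrDr => zyr; suff : `|z| < `|z| by rewrite ltxx.
by apply: le_lt_trans zyr; rewrite -{1}(subrK y z) (le_trans (ler_normD _ _))// lerD2l.
Qed.

Lemma norm_le_compact {R : realType} {cplx : bool} (r : scalars R cplx) :
  compact [set z : scalars R cplx | `|z| <= r].
Proof.
have closed_disk := @closed_norm_le (scalars R cplx) (scalars R cplx)^o r.
case: cplx r closed_disk => /= [[a b]|r] closed_disk.
(* The complex disk is a closed subset of the image of a square whose half-side [a] is the real part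
   of the radius. *)
- pose f (p : R * R) : scalars R true := (p.1 +i* p.2)%C.
  apply: (@subclosed_compact _ _ (f @` (`[- a, a]%classic `*` `[- a, a]%classic))).
  + exact: closed_disk.
  + apply: continuous_compact; last by apply: compact_setX; exact: segment_compact.
    apply: continuous_subspaceT => -[x y]; apply/cvgrPdist_lt => -[e e'].
    rewrite ltcE /= => /andP[/eqP -> e0].
    have nC (u v : R) : `|(u +i* v)%C| <= (`|u| + `|v|)%:C%C.
      rewrite normc_def lecR -[leRHS]ger0_norm ?addr_ge0// -sqrtr_sqr.
      rewrite ler_sqrt ?sqr_ge0// sqrrD !real_normK ?num_real//.
      by rewrite lerD2r lerDl mulrn_wge0// mulr_ge0.
    near=> z; apply: le_lt_trans (nC (x - z.1) (y - z.2)) _.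
    rewrite ltcR (splitr e) ltrD//; near: z.
      apply: (@cvgr_dist_lt _ _ _ (nbhs (x, y)) _ fst); last by rewrite divr_gt0.
      exact: cvg_fst.
    apply: (@cvgr_dist_lt _ _ _ (nbhs (x, y)) _ snd); last by rewrite divr_gt0.
      exact: cvg_snd.
  + move=> [x y] /=; rewrite lecE /= => /andP[_ xya].
    exists (x, y) => //=; rewrite !in_itv /= -!ler_norml.
    split; apply: le_trans xya; rewrite -sqrtr_sqr ler_sqrt ?addr_ge0 ?sqr_ge0//.
    by rewrite lerDl sqr_ge0.
    by rewrite lerDr sqr_ge0.
- apply: (@subclosed_compact _ _ `[-r, r]%classic).
  + exact: closed_disk.
  + exact: segment_compact.
  + by move=> x /=; rewrite in_itv/= ler_norml.
Unshelve. all: by end_near.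
Qed.

Lemma cluster_cvg_eq {S U : topologicalType} (f : S -> U) (F : set_system S) p q :
  hausdorff_space U -> cluster F p -> {for p, continuous f} ->
  f @ F --> q -> f p = q.
Proof.
move=> Uhaus Fp fp fq; apply/esym/Uhaus => A B qA pB.
by have [z [Az Bz]] := Fp _ _ (fq _ qA) (fp _ pB); exists (f z).
Qed.

(** * Almost periodic functions *)

Section almost_periodic.
Context {R : realType} {K : numFieldType} {E : normedModType K}.
Implicit Types (f : R -> E) (e : K).

Let uniform_norm_nbhs (g : {uniform R -> E}) e : 0 < e ->
  nbhs g [set h : {uniform R -> E} | forall s, `|g s - h s| < e].
Proof.
move=> e0; apply/uniform_nbhs; exists [set xy | ball xy.1 e xy.2].
split; first exact: (entourage_ball _ (PosNum e0)).
by move=> h /= gh s; have := gh s I; rewrite -ball_normE.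
Qed.

Let translate f (tau : R) : {uniform R -> E} := fun s => f (s + tau).

Let translateP f tau : almost_periodic f ->
  (@Cb R K E `&` closure (translates f)) (translate f tau).
Proof.
move=> [[cf bf] _]; split; last by apply: subset_closure; exists tau.
split.
  move=> s; apply: (@continuous_comp _ _ _ (fun s => s + tau) f); last exact: cf.
  by apply: cvgD; [exact: cvg_id|exact: cvg_cst].
by move: bf; rewrite /bounded_near; apply: filterS => M fM s _; exact: fM.
Qed.

(** Compactness is available for translates rather than for values: if the translates by times along
    [F] cluster uniformly at [g], their values at 0 cluster at [g 0]. *)
Lemma almost_periodic_cluster f (F : set_system R) : almost_periodic f ->
  ProperFilter F -> cluster (f @ F) !=set0.
Proof.
move=> fap FF; have [_ cf] := fap.
have FC : (translate f @ F) (@Cb R K E `&` closure (translates f)).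
  by apply: (@filterE _ F) => tau; exact: translateP.
have [g [_ Fg]] := cf _ (fmap_proper_filter _ _) FC.
exists (g 0) => A B FA /nbhs_ballP[e /= e0 eB].
have FA' : (translate f @ F) (translate f @` (f @^-1` A)).
  by apply: (filterS (F := F)) (FA : F (f @^-1` A)) => t At; exists t.
have [_ [[t At <-] gt]] := Fg _ _ FA' (uniform_norm_nbhs g e0).
by exists (f t); split => //; apply: eB; rewrite -ball_normE /= -(add0r t); exact: gt.
Qed.

(* Two translates of [f] by multiples of [N] are uniformly close. *)
Lemma almost_periodic_recurrent f (N : R) e : almost_periodic f ->
  0 <= N -> 0 < e -> exists2 tau, N <= tau & `|f tau - f 0| < e.
Proof.
move=> fap N0 e0; have [_ cf] := fap.
pose u n := translate f (N *+ n).
have uC : (u @ \oo) (@Cb R K E `&` closure (translates f)).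
  by apply: (@filterE _ \oo) => n; exact: translateP.
have [g [_ ug]] := cf _ (fmap_proper_filter _ _) uC.
have u_after n : exists2 m, (n <= m)%N & forall s, `|g s - u m s| < e / 2.
  have un : (u @ \oo) (u @` [set m | (n <= m)%N]) by exists n => // m nm; exists m.
  have [_ [[m nm <-] gm]] := ug _ _ un (uniform_norm_nbhs g (divr_gt0 e0 (ltr0Sn K 1))).
  by exists m.
(* Two indices [n < m] give translates within [e / 2] of the same [g]. At the point [- (N *+ n)]
   these translates take the values [f 0] and [f (N *+ (m - n))], and [n < m] makes the time at
   least [N]. *)
have [n _ gn] := u_after 0; have [m nm gm] := u_after n.+1.
exists (N *+ (m - n)).
  by rewrite -[leLHS]mulr1n ler_wpMn2l // subn_gt0.
have gn' : `|g (- (N *+ n)) - f 0| < e / 2.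
  by rewrite -(addNr (N *+ n)); exact: gn.
have gm' : `|g (- (N *+ n)) - f (N *+ (m - n))| < e / 2.
  by rewrite mulrnBr ?(ltnW nm)// (addrC (N *+ m)); exact: gm.
rewrite (splitr e) -(subrKA (g (- (N *+ n)))).
by apply: le_lt_trans (ler_normD _ _) _; apply: ltrD => //; rewrite distrC.
Qed.

End almost_periodic.

(** * The compactification of the sun dual semigroup *)

Section compactification.
Context {R : realType} {cplx : bool}.
Local Notation K := (scalars R cplx).
Context {X : normedModType K} (T : bounded_C0_semigroup X).
Local Notation L := (blin (sun T) (sun T)).
Implicit Types (V W : L) (phi psi : sun T) (x : X) (s t : {nonneg R}).

Lemma sg_comm t s x : T t%:num (T s%:num x) = T s%:num (T t%:num x).
Proof.
by rewrite -[LHS]/((T t%:num \o T s%:num) x) -sg_opD// addrC sg_opD.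
Qed.

Lemma sun_ext phi psi : (forall x, sun_val phi x = sun_val psi x) -> phi = psi.
Proof. by move=> e; apply/val_inj/val_inj/funext. Qed.

Lemma kappa_cvgP (F : set_system L) V : Filter F ->
  F --> (V : kappa_sun T) <->
  forall phi x, sun_val (W phi) x @[W --> F] --> (sun_val (V phi) x : K).
Proof.
move=> FF; split=> [/cvg_initial_ptwsP FV phi x|FV]; first exact: (FV (phi, x)).
by apply/cvg_initial_ptwsP => -[phi x]; exact: FV.
Qed.

Lemma sigma_sun_X_cvgP {I : Type} (F : set_system I) (g : I -> sun T) phi :
  Filter F ->
  g i @[i --> F] --> (phi : sigma_sun_X T) <->
  forall x, sun_val (g i) x @[i --> F] --> (sun_val phi x : K).
Proof. by move=> FF; exact: cvg_initial_ptwsP. Qed.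

Lemma sigma_sun_dual_cvgP {I : Type} (F : set_system I) (g : I -> sun T) phi :
  Filter F ->
  g i @[i --> F] --> (phi : sigma_sun_dual T) <->
  forall xi : dual (sun T), xi (g i) @[i --> F] --> (xi phi : K).
Proof. by move=> FF; exact: cvg_initial_ptwsP. Qed.

Lemma sigma_X_sun_cvgP {I : Type} (F : set_system I) (g : I -> X) x :
  Filter F ->
  g i @[i --> F] --> (x : sigma_X_sun T) <->
  forall phi, sun_val phi (g i) @[i --> F] --> (sun_val phi x : K).
Proof. by move=> FF; exact: cvg_initial_ptwsP. Qed.

Lemma kappa_hausdorff : hausdorff_space (kappa_sun T).
Proof.
apply: initial_hausdorff.
  move=> V W VW; apply/val_inj/funext => phi; apply: sun_ext => x.
  by have := congr1 (fun f => f (phi, x)) VW.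
by apply: hausdorff_product => ?; exact: norm_hausdorff.
Qed.

Lemma blin_comp_kappa_continuous V :
  continuous ((fun W => blin_comp W V) : kappa_sun T -> kappa_sun T).
Proof.
move=> W; have FF : Filter ((blin_comp ^~ V) @ nbhs (W : kappa_sun T)).
  exact: fmap_filter.
apply/(kappa_cvgP _ FF) => phi x.
have WW : nbhs (W : kappa_sun T) --> (W : kappa_sun T) by [].
exact: (proj1 (kappa_cvgP _ _) WW (V phi) x).
Qed.

Lemma S0_net V : S0 T V -> exists (D : directed_set) (t : D -> {nonneg R}),
  forall phi x,
    sun_val phi (T (t i)%:num x) @[i --> @tails D] --> (sun_val (V phi) x : K).
Proof.
move=> /closure_range_net[D [t tV]]; exists D, t => phi x.
have tF := tails_filter D.
by have /kappa_cvgP := tV; exact.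
Qed.

Lemma S0_limit {I : Type} (F : set_system I) (g : I -> L) V : ProperFilter F ->
  (forall i, S0 T (g i)) ->
  (forall phi x,
    sun_val (g i phi) x @[i --> F] --> (sun_val (V phi) x : K)) ->
  S0 T V.
Proof.
move=> FF gS0 gV; have : g @ F --> (V : kappa_sun T) by apply/kappa_cvgP.
move=> {}gV; apply: closed_closure => B /gV FB.
by have [i Bgi] := filter_ex (FB : F (g @^-1` B)); exists (g i); split=> //; exact: gS0.
Qed.

Lemma S0_sun_op t : S0 T (sun_op T t).
Proof. by apply: subset_closure; exists t. Qed.

(** The operators [T t] commute with one another, and this survives the limit because pairing with
    [T t x] is among the scalar limits that determine [V]. *)
Lemma S0_sun_opC V t phi : S0 T V -> V (sun_op T t phi) = sun_op T t (V phi).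
Proof.
move=> /S0_net[D [s sV]]; have tF := tails_filter D; apply: sun_ext => x.
apply: (cvg_unique (@norm_hausdorff K K^o) (sV (sun_op T t phi) x)).
have := sV phi (T t%:num x); apply: cvg_trans; apply: near_eq_cvg.
by apply: nearW => i /=; rewrite sg_comm.
Qed.

(** Left multiplication by [sun_op T t] respects kappa limits because it is the adjoint of an
    operator on [X]. *)
Lemma S0_sun_op_comp V t : S0 T V -> S0 T (blin_comp (sun_op T t) V).
Proof.
move=> /S0_net[D [s sV]]; have tF := tails_filter D.
apply: (@S0_limit _ (@tails D) (fun i => blin_comp (sun_op T t) (sun_op T (s i)))).
- move=> i; have st0 : 0 <= (s i)%:num + t%:num :> R by [].
  suff -> : blin_comp (sun_op T t) (sun_op T (s i)) = sun_op T (NngNum st0).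
    exact: S0_sun_op.
  apply/val_inj/funext => phi; apply: sun_ext => x /=.
  by rewrite sg_opD.
- by move=> phi x; exact: sV.
Qed.

(** The limit is taken one factor at a time: semigroup operators composed with [W] are already in
    [S0], and right multiplication by [W] passes to the limit [V]. *)
Lemma S0_comp V W : S0 T V -> S0 T W -> S0 T (blin_comp V W).
Proof.
move=> /S0_net[D [s sV]] WS; have tF := tails_filter D.
apply: (@S0_limit _ (@tails D) (fun i => blin_comp (sun_op T (s i)) W)).
- by move=> i; exact: S0_sun_op_comp.
- by move=> phi x; exact: sV.
Qed.

(** The bound of the semigroup survives weak limits, so every coefficient of an element of [S0]
    stays in a compact disk independent of that element. *)
Lemma S0_bounded : exists2 M : K, 0 <= M & forall V phi x, S0 T V ->
  `|sun_val (V phi) x| <= M * `|phi| * `|x|.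
Proof.
have [M TM] := sg_bounded T.
have M0 : 0 <= M by rewrite (le_trans (normr_ge0 (T 0))) ?TM.
exists M => // V phi x /S0_net[D [t tV]]; have tF := tails_filter D.
apply: (@closed_cvg _ _ (@tails D) _ (fun i => sun_val phi (T (t i)%:num x))
  [set z : K^o | `|z| <= M * `|phi| * `|x|]).
- exact: closed_norm_le.
- apply: nearW => i /=; rewrite (mulrC M) -mulrA.
  apply: le_trans (opnorm_ub _ _) _; apply: ler_wpM2l; first exact: opnorm_ge0.
  apply: le_trans (opnorm_ub _ _) _; apply: ler_wpM2r => //; exact: TM.
- exact: tV.
Qed.

(* The limit [b] of an ultrafilter in the topology of pointwise convergence
   comes from an operator on [sun T] because
   [b phi (T t x) - b phi x = b (sun_op T t phi - phi) x]. *)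
Lemma S0_compact : compact (S0 T : set (kappa_sun T)).
Proof.
rewrite compact_ultra => F FU FS; have FF := @ultra_proper _ _ FU.
have [M M0 SM] := S0_bounded.
pose ev (p : (sun T * X)%type) (V : L) : K := sun_val (V p.1) p.2.
pose disk (p : (sun T * X)%type) := [set z : K | `|z| <= M * `|p.1| * `|p.2|].
(* As in the Banach-Alaoglu theorem, compactness of the disks gives every coefficient a limit along
   the ultrafilter. *)
have ev_cvg p : exists z : K, disk p z /\ ev p V @[V --> F] --> z.
  have pF : F (ev p @^-1` disk p) by apply: filterS FS => V; exact: SM.
  have := @norm_le_compact R cplx (M * `|p.1| * `|p.2|); rewrite compact_ultra.
  move=> /(_ (ev p @ F) (fmap_ultra _ FU) pF)[z [pz Fz]]; by exists z.
have [b /all_and2[bM bF]] := choice ev_cvg.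
have blim p z : ev p V @[V --> F] --> z -> b p = z.
  exact: (cvg_unique (@norm_hausdorff K K^o) (bF p)).
have b_lin_l x : linear (fun phi => b (phi, x) : K^o).
  move=> a phi psi; apply: blim; rewrite /ev /=.
  rewrite [X in X @ _ --> _](_ : _ =
      fun V => a * ev (phi, x) V + ev (psi, x) V); last first.
    by apply/funext => V; rewrite linearP.
  by apply: cvgD; [apply: cvgMr; exact: bF|exact: bF].
have b_lin_r phi : linear (fun x => b (phi, x) : K^o).
  move=> a x y; apply: blim; rewrite /ev /=.
  rewrite [X in X @ _ --> _](_ : _ =
      fun V => a * ev (phi, x) V + ev (phi, y) V); last first.
    by apply/funext => V; rewrite linearP.
  by apply: cvgD; [apply: cvgMr; exact: bF|exact: bF].
have b_T phi x t : b (phi, T t%:num x) = b (sun_op T t phi, x).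
  apply: blim; have := bF (sun_op T t phi, x); apply: cvg_trans.
  apply: near_eq_cvg; apply: filterS FS => V VS.
  by rewrite /ev /= S0_sun_opC.
have b_dual phi : (fun x => b (phi, x)) \in blin_pred X K^o.
  apply: (bounded_blinP (b_lin_r phi) (M := M * `|phi|)) => [|x].
    by rewrite mulr_ge0.
  exact: bM (phi, x).
pose B phi : dual X := BLin (b_dual phi).
have B_lin : linear B.
  move=> a phi psi; apply/val_inj/funext => x; exact: b_lin_l.
have B_sub phi psi : B (phi - psi) = B phi - B psi.
  by rewrite -scaleN1r addrC B_lin scaleN1r addrC.
have B_le phi : `|B phi| <= M * `|phi|.
  by apply: opnorm_le => [|x]; [rewrite mulr_ge0|exact: bM (phi, x)].
(* By [b_T], the norm of [adjoint (T t) (B phi) - B phi] is at most [M] times that of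
   [sun_op T t phi - phi], which tends to 0. *)
have B_sun phi : B phi \in sun_pred T.
  apply/asboolP; have /asboolP phi_sun := sunP phi.
  have : M * `|adjoint (T t) (sun_val phi) - sun_val phi| @[t --> 0^'+] --> (0 : K).
    by rewrite -(mulr0 M); exact: cvgMr.
  move=> /cvgr0Pnorm_le Mphi; apply/cvgr0Pnorm_le => e e0; near=> t.
  have t0 : 0 <= t by near: t; exact: nbhs_right_ge.
  apply: le_trans (near (Mphi _ e0) t _); last by [].
  rewrite normr_id ger0_norm ?mulr_ge0//.
  rewrite (_ : _ - _ = B (sun_op T (NngNum t0) phi - phi)); first exact: B_le.
  rewrite B_sub; congr (_ - _); apply/val_inj/funext => x.
  exact: (b_T phi x (NngNum t0)).
pose W0 phi := Sun (B_sun phi).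
have W0_blin : W0 \in blin_pred (sun T) (sun T).
  by apply: (bounded_blinP _ M0) => // a phi psi; apply/val_inj; exact: B_lin.
have FW : F --> (BLin W0_blin : kappa_sun T).
  by apply/kappa_cvgP => phi x; exact: bF (phi, x).
exists (BLin W0_blin); split => //.
by apply: closed_closure => C /FW FC; exact: filter_ex (filterI FS FC).
Unshelve. all: by end_near.
Qed.

Lemma sun_op_le : exists2 M : K, 0 <= M & forall t phi, `|sun_op T t phi| <= M * `|phi|.
Proof.
have [M M0 SM] := S0_bounded; exists M => // t phi.
apply: opnorm_le => [|x]; first by rewrite mulr_ge0.
exact: SM (@S0_sun_op t).
Qed.

Lemma sun_opD s t phi (st0 : 0 <= s%:num + t%:num) :
  sun_op T (NngNum st0) phi = sun_op T t (sun_op T s phi).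
Proof. by apply: sun_ext => x /=; rewrite sg_opD. Qed.

Lemma sun_eval_subproof x : (fun phi => sun_val phi x) \in blin_pred (sun T) K^o.
Proof.
apply: (@bounded_blinP _ _ _ _ `|x|) => // phi.
by rewrite mulrC; exact: opnorm_ub.
Qed.

Definition sun_eval x : dual (sun T) := BLin (sun_eval_subproof x).

Lemma S0_orbit_closure V phi : S0 T V ->
  @closure (sigma_sun_X T) (sun_orbit phi) (V phi).
Proof.
move=> /S0_net[D [t tV]]; have tF := tails_filter D.
have tVphi : sun_op T (t i) phi @[i --> @tails D] --> (V phi : sigma_sun_X T).
  by apply/sigma_sun_X_cvgP => x; exact: tV.
move=> B /tVphi FB.
have [i Bi] := filter_ex (FB : tails D (fun i => B (sun_op T (t i) phi))).
by exists (sun_op T (t i) phi); split => //; exists (t i).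
Qed.

(** * Consequences of the minimality of [P] *)

Section minimal_idempotent.
Context (P : L) (minP : minimal_idempotent (S0 T) P).

Let PS : S0 T P.
Proof. by have [[]] := minP. Qed.

Let PP phi : P (P phi) = P phi.
Proof. by have [[_ /(congr1 (fun V : L => V phi))]] := minP. Qed.

Let P_fixed phi : range P phi -> P phi = phi.
Proof. by case=> psi _ <-. Qed.

Lemma minimal_left_inverse V : S0 T V ->
  exists2 U, S0 T U & forall phi, U (V (P phi)) = P phi.
Proof.
move=> VS; have [_ Pmin] := minP.
have [||f fS ff fP|U US UVP] := @minimal_idempotent_left_inverse (kappa_sun T)
    (@blin_comp _ _ _ _) _ kappa_hausdorff blin_comp_kappa_continuous (S0 T) P V
    S0_compact S0_comp PS _ _ VS.
- by move=> ? ? ?; exact/val_inj.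
- by have [[]] := minP.
- exact: Pmin (conj fS ff) fP.
by exists U => // phi; exact: (congr1 (fun W : L => W phi) UVP).
Qed.

(** In the monoid [P S0 P] with unit [P], every element has a left inverse; the left inverse has one
    too, so it is two-sided. *)
Lemma minimal_inverse V : S0 T V -> exists2 U, S0 T U & forall phi,
  P (U (P (V (P phi)))) = P phi /\ P (V (P (U (P phi)))) = P phi.
Proof.
move=> VS; have [U US UV] := minimal_left_inverse (S0_comp PS VS).
have [W WS WU] := minimal_left_inverse (S0_comp PS US).
exists U => // phi; have UVP psi : P (U (P (V (P psi)))) = P psi.
  by rewrite [U _]UV PP.
split; first exact: UVP.
by rewrite -[LHS]WU /= UVP WU.
Qed.

(** On [range P] the operators [P V] and [P V P] agree, so [P] restricts to the identity and
    [minimal_inverse] supplies the inverses. *)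
Lemma range_minimal_group :
  transformation_group
    (restrictions (range P) [set (blin_comp P V : sun T -> sun T) | V in S0 T]).
Proof.
split.
- exists P; first by exists P => //; apply/funext => phi /=; rewrite PP.
  by move=> a; apply/esym/P_fixed; exact: set_valP.
- move=> g h [_ [V VS <-] gV] [_ [W WS <-] hW].
  exists (blin_comp P (blin_comp V (blin_comp P W))).
    by exists (blin_comp V (blin_comp P W)) => //; do !apply: S0_comp.
  by move=> a /=; rewrite gV hW.
- move=> g [_ [V VS <-] gV]; have [U US UV] := minimal_inverse VS.
  have PUr (a : range P) : P (U (set_val a)) \in range P.
    by apply/mem_set; exists (U (set_val a)).
  exists (fun a => SigSub (PUr a)); split.
  + exists (blin_comp P U); first by exists U.
    by [].
  + apply/funext => a; apply/val_inj; have [_] := UV (set_val a).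
    by rewrite (P_fixed (set_valP a)); apply: etrans; exact: gV.
  + apply/funext => a; apply/val_inj; have [+ _] := UV (set_val a).
    rewrite (P_fixed (set_valP a)); apply: etrans.
    exact: (congr1 (fun chi => P (U chi)) (gV a)).
Qed.

Lemma almost_periodic_range phi :
  almost_periodic_half_line (fun t => sun_op T t phi) -> P phi = phi.
Proof.
move=> [f fap fT]; have [D [t tP]] := S0_net PS; have tF := tails_filter D.
pose F := (fun i => (t i)%:num) @ @tails D.
have [c Fc] := almost_periodic_cluster fap (fmap_proper_filter _ _ : ProperFilter F).
(* The orbit has a norm cluster point [c] along the times for which [sun_op T t] tends to [P];
   pairing with each [x] identifies [c] with [P phi]. *)
have {Fc} FP : cluster (f @ F) (P phi).
  suff <- : c = P phi by [].
  apply: sun_ext => x.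
  apply: (cluster_cvg_eq (f := sun_eval x) (@norm_hausdorff K K^o) Fc).
    exact: blin_continuous.
  have fE : (fun i => sun_eval x (f (t i)%:num)) =
      fun i => sun_val phi (T (t i)%:num x).
    by apply/funext => i; rewrite fT.
  by rewrite -[_ @ _]/((fun i => sun_eval x (f (t i)%:num)) @ @tails D) fE; exact: tP.
have [M M0 TM] := sun_op_le.
set psi := phi - P phi; pose C := `|P| + 1.
have C0 : 0 <= C by rewrite addr_ge0.
have PB u v : P (u - v) = P u - P v by exact: linearB.
have I_P chi : `|chi - P chi| <= C * `|chi|.
  rewrite /C mulrDl mul1r; apply: le_trans (ler_normB _ _) _.
  by rewrite addrC lerD2r; exact: opnorm_ub.
(* Choose [s] with [sun_op T s phi] within [e] of [P phi], then a return time [tau >= s] with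
   [sun_op T tau phi] within [e] of [phi]. Since [C] bounds [id - P], [psi] moves by at most [C * e]
   up to time [tau], while [sun_op T tau psi] factors through [sun_op T s psi] and has norm at most
   [M * C * e]. *)
have psi_le e : 0 < e -> `|psi| <= (C + M * C) * e.
  move=> e0.
  have F_orbit : (f @ F) (sun_orbit phi).
    by apply: (@filterE _ (@tails D)) => i; exists (t i); rewrite // fT.
  have [_ [[s _ <-]]] := FP _ _ F_orbit (nbhsx_ballx _ _ e0).
  rewrite -ball_normE /= distrC => sP.
  have s0 : 0 <= s%:num :> R by [].
  have [tau stau ftau] := almost_periodic_recurrent fap s0 e0.
  have r0 : 0 <= tau - s%:num by rewrite subr_ge0.
  have st0 : 0 <= s%:num + (NngNum r0)%:num by [].
  have tauE : tau = (NngNum st0)%:num by rewrite /= addrC subrK.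
  have T0 : f 0 = phi.
    have := fT (NngNum (lexx (0 : R))) => /= ->.
    by apply: sun_ext => x /=; rewrite sg_op0.
  have psiE u : sun_op T u psi = sun_op T u phi - P (sun_op T u phi).
    by rewrite linearB S0_sun_opC.
  rewrite -(subrK (sun_op T (NngNum st0) psi) psi) mulrDl.
  apply: le_trans (ler_normD _ _) _; apply: lerD.
    have -> : psi - sun_op T (NngNum st0) psi =
        (phi - sun_op T (NngNum st0) phi) - P (phi - sun_op T (NngNum st0) phi).
      rewrite psiE PB !opprB [X in _ + X = _]addrC addrACA.
      by congr (_ + _); exact: addrC.
    apply: le_trans (I_P _) _; apply: ler_wpM2l => //.
    by rewrite ltW // distrC -fT -tauE -T0.
  rewrite sun_opD -mulrA; apply: le_trans (TM _ _) _; apply: ler_wpM2l => //.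
  have -> : sun_op T s psi = (sun_op T s phi - P phi) - P (sun_op T s phi - P phi).
    by rewrite psiE PB PP opprB subrKA.
  by apply: le_trans (I_P _) _; apply: ler_wpM2l => //; exact: ltW.
have psi0 : psi = 0.
  apply/eqP/contraT; rewrite -normr_gt0 => n0; set A := C + M * C in psi_le.
  have A0 : 0 <= A by rewrite addr_ge0 ?mulr_ge0.
  have A1 : 0 < A + 1 by rewrite ltr_wpDl.
  (* With [e] equal to the norm of [psi] divided by [A + 1], the estimate would give
     [A + 1 <= A]. *)
  have := psi_le _ (divr_gt0 n0 A1); rewrite mulrCA ler_pMr// ler_pdivlMr// mul1r.
  by rewrite gerDl ler10.
by apply/eqP; rewrite eq_sym -subr_eq0 -/psi psi0.
Qed.

Lemma weak_null_orbit_kernel phi (D : directed_set) (t : D -> {nonneg R}) :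
  @net_cvg (sigma_sun_dual T) D (fun i => sun_op T (t i) phi) (0 : sun T) ->
  P phi = 0.
Proof.
have tF := tails_filter D.
move=> /(sigma_sun_dual_cvgP _ _ tF) t0.
pose F := (fun i => sun_op T (t i) : kappa_sun T) @ @tails D.
have FS : F (S0 T) by apply: (@filterE _ (@tails D)) => i; exact: S0_sun_op.
have [V [VS FV]] := S0_compact (fmap_proper_filter _ _ : ProperFilter F) FS.
have [U US UV] := minimal_left_inverse VS.
(* Here [V] is a kappa cluster point of the operators [sun_op T (t i)], and [U] undoes it on
   [range P]. *)
rewrite -UV; suff -> : V (P phi) = 0 by rewrite linear0.
apply: sun_ext => x.
apply: (cluster_cvg_eq (f := (fun W : kappa_sun T => sun_val ((W : L) (P phi)) x : K^o))
  (@norm_hausdorff K K^o) FV).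
  have VV : nbhs (V : kappa_sun T) --> (V : kappa_sun T) by [].
  exact: (proj1 (kappa_cvgP _ _) VV (P phi) x).
(* Weak convergence is tested on the functional [sun_eval x] composed with [P]; commuting [P] past
   the semigroup turns this into the orbit of [P phi]. *)
have := t0 (blin_comp (sun_eval x) P); rewrite linear0.
suff -> : (fun i => blin_comp (sun_eval x) P (sun_op T (t i) phi)) =
  fun i => sun_val (sun_op T (t i) (P phi)) x by [].
by apply/funext => i /=; rewrite S0_sun_opC.
Qed.

End minimal_idempotent.
End compactification.

(** * The splitting of the sun dual by [P] *)

Theorem theorem5p9 (R : realType) (cplx : bool)
    (X : completeNormedModType (scalars R cplx))
    (T : bounded_C0_semigroup X) (P : blin (sun T) (sun T))
    (minP : minimal_idempotent (S0 T) P) :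
  let Xa : set (sun T) := range P in
  let X0 : set (sun T) := P @^-1` [set 0] in
  let PS0 : set (sun T -> sun T) :=
    [set (blin_comp P V : sun T -> sun T) | V in S0 T] in
  (* decomposition into closed translation-invariant subspaces *)
  ([/\ is_subspace Xa, closed Xa &
       forall (t : {nonneg R}) phi, Xa phi -> Xa (sun_op T t phi)] /\
   [/\ is_subspace X0, closed X0 &
       forall (t : {nonneg R}) phi, X0 phi -> X0 (sun_op T t phi)] /\
   is_direct_sum Xa X0 [set: sun T]) /\
  (* 1 *)
  ((forall g phi, PS0 g -> Xa phi -> Xa (g phi)) /\
   transformation_group (restrictions Xa PS0)) /\
  (* 2 *)
  (forall phi : sun T, Xa phi <->
    forall V, S0 T V -> exists2 U, S0 T U & P (U (P (V phi))) = phi) /\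
  (* 3 *)
  (forall phi : sun T, X0 phi ->
    exists (D : directed_set) (t : D -> {nonneg R}),
      @net_cvg (sigma_sun_X T) D (fun i => sun_op T (t i) phi) (0 : sun T)) /\
  (* 4 *)
  (forall phi : sun T,
    almost_periodic_half_line (fun t : {nonneg R} => sun_op T t phi) ->
    Xa phi) /\
  (* 5 *)
  (forall phi : sun T,
    (exists (D : directed_set) (t : D -> {nonneg R}),
      @net_cvg (sigma_sun_dual T) D (fun i => sun_op T (t i) phi)
        (0 : sun T)) ->
    X0 phi) /\
  (* 6 *)
  (forall x : X, pre_annihilator Xa x ->
    exists (D : directed_set) (t : D -> {nonneg R}),
      @net_cvg (sigma_X_sun T) D (fun i => T (t i)%:num x) (0 : X)) /\
  (* 7 *)
  (forall x : X, pre_annihilator X0 x ->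
    exists (D : directed_set) (t : D -> {nonneg R}),
      @net_cvg (sigma_X_sun T) D (fun i => T (t i)%:num x) x) /\
  (* 8 *)
  (forall Y : set (sun T), is_subspace Y -> closed Y ->
    (forall phi phia phi0 : sun T, Y phi ->
      Xa phia -> X0 phi0 -> phi = phia + phi0 ->
      @closure (sigma_sun_X T) (sun_orbit phi) `<=` Y ->
      Y phia /\ Y phi0) /\
    ((forall phi, Y phi ->
        @closure (sigma_sun_X T) (sun_orbit phi) `<=` Y) ->
     is_direct_sum (Y `&` Xa) (Y `&` X0) Y)).
Proof.
move=> Xa X0 PS0; have [[PS PPE] _] := minP.
have PP phi : P (P phi) = P phi.
  exact: (congr1 (fun V : blin (sun T) (sun T) => V phi) PPE).
have XaP phi : Xa phi <-> P phi = phi.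
  by split=> [[psi _ <-]|<-]; [exact: PP|exists phi].
have PB u v : P (u - v) = P u - P v by exact: linearB.
have X0_sub phi : X0 (phi - P phi) by rewrite /X0 /= PB PP subrr.
have Xa0 phi : Xa phi -> X0 phi -> phi = 0 by move=> /XaP Pa P0; rewrite -Pa.
(* This single net, along which [sun_op T t] tends to [P], serves claims 3, 6 and 7. *)
have [D [t tP]] := S0_net PS; have tF := tails_filter D.
split; [split; [split; [split| |]|split; [split; [split| |]|split]]|].
- by exists 0; rewrite ?linear0.
- move=> a _ _ [u _ <-] [v _ <-]; exists (a *: u + v) => //; exact: linearP.
- rewrite (_ : Xa = (fun phi => P phi - phi) @^-1` [set 0]).
    apply: preimage_closed; last exact: accessible_closed_set1
      (hausdorff_accessible (@norm_hausdorff _ _)) _.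
    move=> phi _; apply: (cvgB (@blin_continuous _ _ _ P phi)); exact: cvg_id.
  apply/seteqP; split=> phi /=; first by move=> /XaP ->; rewrite subrr.
  by move=> /eqP; rewrite subr_eq0 => /eqP/XaP.
- by move=> s _ [u _ <-]; exists (sun_op T s u) => //; exact: S0_sun_opC.
- exact: linear0.
- by move=> a u v; rewrite /X0 /= => Pu Pv; rewrite blin_linear Pu Pv scaler0 addr0.
- apply: preimage_closed; last exact: accessible_closed_set1
    (hausdorff_accessible (@norm_hausdorff _ _)) _.
  by move=> phi _; exact: blin_continuous.
- by move=> s phi Pphi; rewrite /X0 /= S0_sun_opC// Pphi linear0.
- apply/seteqP; split=> // phi _; exists (P phi); first by exists phi.
  by exists (phi - P phi) => //; rewrite addrC subrK.
- apply/seteqP; split=> [phi [Pa P0]|_ ->] /=; first exact: Xa0.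
  by split; [exists 0; rewrite ?linear0|exact: linear0].
split; [split|].
- by move=> _ phi [V VS <-] _; exists (V phi).
- exact: (range_minimal_group minP).
split; [move=> phi; split|].
- move=> phiP V VS; have [U US UV] := minimal_inverse minP VS.
  by exists U => //; move/XaP: phiP => <-; have [+ _] := UV phi.
(* Taking [V] to be [P] already exhibits [phi] as a value of [P]. *)
- by move=> /(_ P PS)[U _ <-]; exists (U (P (P phi))).
split; [|split; [|split; [|split; [|split]]]].
- move=> phi Pphi; exists D, t; apply/sigma_sun_X_cvgP => x.
  by rewrite -Pphi; exact: tP.
- by move=> phi /(almost_periodic_range minP)/XaP.
- by move=> phi [D' [t' /(weak_null_orbit_kernel minP)]].
- move=> x xa; exists D, t; apply/sigma_X_sun_cvgP => phi.
  rewrite linear0 -(xa (P phi)); first exact: tP.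
  by exists phi.
(* The limit of the pairings is that of [P phi] with [x]; it equals that of [phi] with [x] because
   [phi - P phi] lies in the kernel. *)
- move=> x x0; exists D, t; apply/sigma_X_sun_cvgP => phi.
  suff -> : sun_val phi x = sun_val (P phi) x by exact: tP.
  by apply/eqP; rewrite -subr_eq0; apply/eqP; exact: (x0 (phi - P phi)).
- move=> Y [Y0 Ylin] clY.
  have Ysplit phi phia phi0 : Y phi -> Xa phia -> X0 phi0 -> phi = phia + phi0 ->
      @closure (sigma_sun_X T) (sun_orbit phi) `<=` Y -> Y phia /\ Y phi0.
    move=> Yphi /XaP Pa P0 phiE orbY.
    have Ya : Y phia.
      (* The range component is [P phi], a weak limit point of the orbit and hence in [Y]. *)
      have <- : P phi = phia by rewrite phiE linearD /= Pa P0 addr0.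
      by apply: orbY; exact: S0_orbit_closure.
    split => //; have -> : phi0 = (-1) *: phia + phi.
      by rewrite phiE scaleN1r addKr.
    exact: Ylin.
  split=> // orbY; split; apply/seteqP; split.
  + move=> _ [a [Ya _] [b [Yb _] <-]].
    by rewrite -(scale1r a); exact: Ylin.
  + move=> phi Yphi.
    have [||||Ya Yb] := Ysplit phi (P phi) (phi - P phi) Yphi.
    * by exists phi.
    * exact: X0_sub.
    * by rewrite addrC subrK.
    * exact: orbY.
    exists (P phi); first by split => //; exists phi.
    by exists (phi - P phi) => //; rewrite addrC subrK.
  + by move=> phi [[_ Pa] [_ P0]]; exact: Xa0.
  + move=> _ -> /=; split; split => //; last exact: linear0.
    by exists 0; rewrite ?linear0.
Qed.
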